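(* Let $\kappa>0$ be a constant and let $\sigma\ge 0$ be the constant in the entropy flux. The DG semi-discretization of the viscous Burgers equation described in the context, with solution $u=u(t)\in V_h(\Omega_h)$ (and associated $q=q(t)\in V_h(\Omega_h)$) and with zero Dirichlet or periodic boundary conditions, is stable in the following sense: $$\|u(t)\|_{\Omega_h}^2 + C\int_0^t\|u(\tau)\|_{DG}^2\,d\tau \le \|u(0)\|_{\Omega_h}^2,$$ where $C$ is some positive constant and $u(0)$ is the DG initial condition. Hence, the DG solution is unique.
   Context: Mesh and notation. $\Omega\subset\mathbb{R}$ is a bounded open interval, partitioned into a mesh $\Omega_h$ of finitely many non-overlapping elements (intervals) $K$, with $h=\max_K \mathrm{diam}(K)$. $\partial\Omega_h$ is the collection of all element boundaries $\partial K$, and $\mathcal{E}_h$ is the set of all uniquely defined faces (points). $V_h(\Omega_h)=\{v\in L^2(\Omega_h): v|_K\in\mathcal{P}^k(K)\ \forall K\in\Omega_h\}$, where $\mathcal{P}^k$ is the space of polynomials of degree at most $k$. $n=\pm1$ denotes the unit outward normal of an element. On an interior face $e=K^+\cap K^-$, with traces $v^\pm$ and normals $n^\pm$ ($n^+=-n^-$), $\{\!\{v\}\!\}=(v^-+v^+)/2$ and $[\![v]\!]=v^-n^-+v^+n^+$; on a boundary face $\{\!\{v\}\!\}=v$ and $[\![v]\!]=v\,n$. Inner products: $(\cdot,\cdot)_{\Omega_h}=\sum_K(\cdot,\cdot)_{L^2(K)}$, $\langle\cdot,\cdot\rangle_{\partial\Omega_h}=\sum_K\langle\cdot,\cdot\rangle_{\partial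 K}$, $\langle\cdot,\cdot\rangle_{\mathcal{E}_h}=\sum_{e\in\mathcal{E}_h}\langle\cdot,\cdot\rangle_e$, with associated norms $\|\cdot\|_{\Omega_h}$, $\|\cdot\|_{\partial\Omega_h}$, $\|\cdot\|_{\mathcal{E}_h}$. Spatial derivatives are taken element by element. All integrals are assumed to be computed exactly. DG norm: $\|u\|_{DG}^2=\left\|\frac{\partial u}{\partial x}\right\|_{\Omega_h}^2+\frac1h\|[\![u]\!]\|_{\mathcal{E}_h}^2$. (For periodic boundary conditions the boundary and interior interfaces are treated the same in this norm.) DG scheme for $\frac{\partial u}{\partial t}+\frac12\frac{\partial u^2}{\partial x}=\frac{\partial}{\partial x}\left(\kappa\frac{\partial u}{\partial x}\right)$: given a reference state $\tilde u$, find $u,q\in V_h(\Omega_h)$ such that for all $p,v\in V_h(\Omega_h)$ $$(q,p)_{\Omega_h}=\left(\tfrac{\partial u}{\partial x},p\right)_{\Omega_h}+\langle n(u^{**}-u),p\rangle_{\partial\Omega_h},\qquad \left(\tfrac{\partial u}{\partial t},v\right)_{\Omega_h}=\langle Lu,v\rangle+\langle\mathcal{N}(u),v\rangle,$$ where $$\langle Lu,v\rangle=-\left(\kappa q-\tilde u u,\tfrac{\partial v}{\partial x}\right)_{\Omega_h}+\langle n(\kappa q^{**}-(\tilde u u)^* ),v\rangle_{\partial\Omega_h},$$ $$\langle\mathcal{N}(u),v\rangle=-\left(\tilde u u-\tfrac12u^2,\tfrac{\partial v}{\partial x}\right)_{\Omega_h}+\left\langle n\left((\tilde u u)^*-\left(\tfrac{u^2}{2}\right)^*\right),v\right\rangle_{\partial\Omega_h},$$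 with numerical fluxes $u^{**}=\{\!\{u\}\!\}$, $q^{**}=\{\!\{q\}\!\}$, the entropy flux $\left(\frac{u^2}{2}\right)^*=\frac13\left(\{\!\{\frac12u^2\}\!\}+\{\!\{u\}\!\}^2\right)+\frac{\sigma}{h}[\![u]\!]$ with a constant $\sigma\ge 0$, and $(\tilde uu)^*=\{\!\{\tilde uu\}\!\}+\frac12\max(|\tilde u^\pm|)[\![u]\!]$. Boundary conditions are either periodic or zero Dirichlet on both sides of $\Omega$; at a Dirichlet boundary one takes $u^+=0$ in $(\tilde uu)^*$ and $\left(\frac{u^2}{2}\right)^*$, $u^{**}=0$, and $q^{**}=q^-$ (interior trace).
   Formalization: For σ>0 the constant C is positive as stated; for σ=0 only C≥0 (L² stability) is claimed, because with σ=0 the scheme can have stationary solutions with nonzero DG norm (e.g. u=1, one element, k=0, Dirichlet). Uniqueness is kept for all σ≥0. *)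

(* Defs.v *)
From HB Require Import structures.
From mathcomp Require Import all_boot all_order all_algebra.
From mathcomp Require Import all_classical all_reals all_analysis.
Import Order.TTheory GRing.Theory Num.Theory.
Import numFieldNormedType.Exports.

Set Implicit Arguments.
Unset Strict Implicit.
Unset Printing Implicit Defensive.

Local Open Scope classical_set_scope.
Local Open Scope ring_scope.

(* A mesh of Omega = ]node ord0, node ord_max[ into n.+1 elements; element j is
   the interval between the nodes of indices j and j.+1. *)
Record mesh (R : realType) (n : nat) := Mesh {
  node : 'I_n.+2 -> R;
  node_incr : forall i j : 'I_n.+2, (i < j)%N -> node i < node j }.

Inductive bcond := Dirichlet | Periodic.

Section DG.
Variables (R : realType) (n k : nat) (M : mesh R n) (bc : bcond).

Implicit Types (j : 'I_n.+1) (i : 'I_n.+2).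

(* Piecewise functions are families indexed by the elements, so that they have
   one value per side at each node; the trace of f on the boundary of element j
   is the value of f j at an endpoint of j. *)
Definition broken := 'I_n.+1 -> R -> R.

Definition Vh := 'I_n.+1 -> {poly_k.+1 R}.

Definition ev (v : Vh) : broken := fun j x => (v j : {poly R}).[x].
Definition dx (v : Vh) : broken := fun j x => (v j : {poly R})^`().[x].

(* Endpoints of element j: [lift ord_max j] has value j (left endpoint) and
   [lift ord0 j] has value j.+1 (right endpoint). *)
Definition vtx j (s : bool) : 'I_n.+2 :=
  if s then lift ord0 j else lift ord_max j.

Definition nrm (s : bool) : R := if s then 1 else -1.

Definition meshsize : R :=
  \big[Num.max/0]_j (node M (vtx j true) - node M (vtx j false)).

Definition elt j : set R := `[node M (vtx j false), node M (vtx j true)].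

(* Elements on the left and on the right of a node. With periodic conditions
   the two end nodes are the same face, between the last and first elements. *)
Definition eltL i : option 'I_n.+1 :=
  match unlift ord0 i, bc with
  | Some j, _ => Some j
  | None, Periodic => Some ord_max
  | None, Dirichlet => None
  end.

Definition eltR i : option 'I_n.+1 :=
  match unlift ord_max i, bc with
  | Some j, _ => Some j
  | None, Periodic => Some ord0
  | None, Dirichlet => None
  end.

Definition trL (f : broken) i : option R :=
  omap (fun j => f j (node M (vtx j true))) (eltL i).
Definition trR (f : broken) i : option R :=
  omap (fun j => f j (node M (vtx j false))) (eltR i).

Definition avg (f : broken) i : R :=
  match trL f i, trR f i with
  | Some a, Some b => (a + b) / 2
  | Some a, None | None, Some a => a
  | None, None => 0
  end.

(* The outward normal is 1 for the element on the left of the face and -1 for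
   the one on its right. On a boundary face only one of the terms is present. *)
Definition jump (f : broken) i : R :=
  odflt 0 (trL f i) * nrm true + odflt 0 (trR f i) * nrm false.

(* Average with exterior trace 0 at a Dirichlet boundary; equal to [avg] on all
   other faces. *)
Definition avg0 (f : broken) i : R :=
  (odflt 0 (trL f i) + odflt 0 (trR f i)) / 2.

Definition boundary_face i : bool :=
  ~~ (isSome (eltL i) && isSome (eltR i)).

(* Each periodic end face is counted once. *)
Definition face i : bool :=
  if bc is Periodic then i != ord0 else true.

Definition ipK (f g : broken) : R :=
  \sum_j \int[lebesgue_measure]_(x in elt j) (f j x * g j x).

(* Data on the boundaries of the elements are families indexed by the element
   and by the side ([true] is the right endpoint). *)
Definition bdata := 'I_n.+1 -> bool -> R.

Definition tr (f : broken) : bdata := fun j s => f j (node M (vtx j s)).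

Definition of_face (F : 'I_n.+2 -> R) : bdata := fun j s => F (vtx j s).

Definition ipB (F G : bdata) : R := \sum_j \sum_(s : bool) F j s * G j s.

Definition ipE (F G : 'I_n.+2 -> R) : R := \sum_(i | face i) F i * G i.

Definition L2sq (f : broken) : R := ipK f f.

Definition DGsq (u : Vh) : R :=
  L2sq (dx u) + meshsize^-1 * ipE (jump (ev u)) (jump (ev u)).

Variables (kappa sigma : R).

Definition uflux (u : Vh) i : R :=
  if boundary_face i then 0 else avg (ev u) i.

Definition qflux (q : Vh) i : R := avg (ev q) i.

Definition entropy_flux (u : Vh) i : R :=
  3^-1 * (avg0 (fun j x => 2^-1 * ev u j x ^+ 2) i + avg0 (ev u) i ^+ 2)
  + sigma / meshsize * jump (ev u) i.

Definition linear_flux (ut : broken) (u : Vh) i : R :=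
  avg0 (fun j x => ut j x * ev u j x) i
  + 2^-1 * Num.max `|odflt 0 (trL ut i)| `|odflt 0 (trR ut i)|
         * jump (ev u) i.

Definition Lform (ut : broken) (u q v : Vh) : R :=
  - ipK (fun j x => kappa * ev q j x - ut j x * ev u j x) (dx v)
  + ipB (fun j s => nrm s * (kappa * of_face (qflux q) j s
                             - of_face (linear_flux ut u) j s))
        (tr (ev v)).

Definition Nform (ut : broken) (u v : Vh) : R :=
  - ipK (fun j x => ut j x * ev u j x - 2^-1 * ev u j x ^+ 2) (dx v)
  + ipB (fun j s => nrm s * (of_face (linear_flux ut u) j s
                             - of_face (entropy_flux u) j s))
        (tr (ev v)).

Definition gradient_eq (u q : Vh) : Prop :=
  forall p : Vh,
    ipK (ev q) (ev p) =
    ipK (dx u) (ev p)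
    + ipB (fun j s => nrm s * (of_face (uflux u) j s - tr (ev u) j s))
          (tr (ev p)).

Definition evolution_eq (ut : broken) (u q w : Vh) : Prop :=
  forall v : Vh, ipK (ev w) (ev v) = Lform ut u q v + Nform ut u v.

(* Continuity and time derivative in the finite-dimensional space Vh, expressed
   on the coefficients of the polynomials. *)
Definition Vh_continuous (A : set R) (u : R -> Vh) : Prop :=
  forall j (m : nat), {within A, continuous (fun t => (u t j : {poly R})`_m)}.

Definition is_dt (u : R -> Vh) (t : R) (w : Vh) : Prop :=
  forall j (m : nat),
    is_derive t 1 (fun s => (u s j : {poly R})`_m) (w j : {poly R})`_m.

Definition DG_solution (ut : R -> broken) (T : R) (u q : R -> Vh) : Prop :=
  [/\ Vh_continuous `[0, T] u,
      forall t, t \in `[0, T] -> gradient_eq (u t) (q t)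
    & forall t, t \in `]0, T[ ->
        exists2 w, is_dt u t w & evolution_eq (ut t) (u t) (q t) w].

(* Reference states: for each time, continuous up to the boundary on each
   element. *)
Definition reference_state (ut : R -> broken) : Prop :=
  forall t j, {within elt j, continuous (ut t j)}.

End DG.

(* Main.v *)
(* Testing the evolution equation with v = u, the reference state cancels, the
   gradient equation turns the viscous terms into - kappa ||q||^2, and the
   entropy flux is such that the cubic terms of each face vanish, leaving
     (u_t, u) = - kappa ||q||^2 - (sigma / h) ||[u]||^2.
   Testing the gradient equation with the derivative of u and using the inverse
   (trace) inequality for polynomials bounds ||u_x||^2 by ||q||^2 and
   ||[u]||^2, so the right-hand side controls the DG norm. For uniqueness, the
   viscous terms of the difference of two solutions are again dissipative and,
   since both solutions are bounded by their initial energy, the nonlinear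
   terms are Lipschitz in L^2; Gronwall's inequality concludes. *)

Require Import Defs.
From HB Require Import structures.
From mathcomp Require Import all_boot all_order all_algebra.
From mathcomp Require Import all_classical all_reals all_analysis.
From mathcomp Require Import ring lra.
Import Order.TTheory GRing.Theory Num.Theory.
Import numFieldNormedType.Exports.

Set Implicit Arguments.
Unset Strict Implicit.
Unset Printing Implicit Defensive.

Local Open Scope classical_set_scope.
Local Open Scope ring_scope.

(** * Differential inequalities in time *)

Section RealAnalysis.
Variable R : realType.
Implicit Types (g D : R -> R) (C T t : R) (A : set R).

Lemma sumr_bool (f : bool -> R) : \sum_s f s = f true + f false.
Proof. exact: big_bool. Qed.

Lemma norm_mul_le (a b A B : R) : `|a| <= A -> `|b| <= B -> `|a * b| <= A * B.
Proof. by move=> aA bB; rewrite normrM ler_pM. Qed.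

Lemma integrable_itvcc a b (f : R -> R) : {within `[a, b], continuous f} ->
  lebesgue_measure.-integrable `[a, b] (EFin \o f).
Proof. exact/continuous_compact_integrable/segment_compact. Qed.

Lemma within_continuousM A (f g : R -> R) : {within A, continuous f} ->
  {within A, continuous g} -> {within A, continuous (fun s => f s * g s)}.
Proof. by move=> cf cg x; apply: cvgM; [exact: cf|exact: cg]. Qed.

Lemma within_continuous_cst A (c : R) : {within A, continuous (fun=> c)}.
Proof. exact/continuous_subspaceT/cst_continuous. Qed.

Lemma within_continuous_sum A (I : Type) (r : seq I) (P : pred I)
    (f : I -> R -> R) :
  (forall i, {within A, continuous (f i)}) ->
  {within A, continuous (fun s => \sum_(i <- r | P i) f i s)}.
Proof.
move=> cf; elim: r => [|i r IH].
  by under eq_fun do rewrite big_nil; exact: within_continuous_cst.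
under eq_fun do rewrite big_cons; case: (P i) => //.
exact: (within_continuousD (cf i) IH).
Qed.

Lemma is_derive_fsum N (h : 'I_N -> R -> R) (dh : 'I_N -> R) (t : R) :
  (forall i, is_derive t 1 (h i) (dh i)) ->
  is_derive t 1 (fun s => \sum_(i < N) h i s) (\sum_(i < N) dh i).
Proof.
move=> H; rewrite (_ : (fun _ => _) = \sum_(i < N) h i).
  exact: is_derive_sum.
by apply/funext => s; rewrite fct_sumE.
Qed.

(** With [F] the primitive of [D], the function [g + C * F] has nonpositive derivative on the open
    interval and is continuous up to its ends, so it does not increase. *)
Lemma integral_inequality g D C T :
  {within `[0, T], continuous g} -> {within `[0, T], continuous D} ->
  (forall t, t \in `]0, T[ ->
    exists2 d, is_derive t 1 g d & d <= - (C * D t)) ->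
  forall t, t \in `[0, T] ->
    g t + C * \int[lebesgue_measure]_(s in `[0, t]) D s <= g 0.
Proof.
move=> cg cD dg t; rewrite in_itv/= => /andP[t0 tT].
(* The case [t = 0] is settled apart, because the fundamental theorem of calculus below is applied
   with [0 < T]. *)
move: t0; rewrite le_eqVlt => /predU1P[<-|t0].
  by rewrite set_itv1 Rintegral_set1 mulr0 addr0.
have T0 : 0 < T := lt_le_trans t0 tT.
have iD := integrable_itvcc cD.
have [F [FE cF dF]] : exists F : R -> R,
    [/\ forall s, F s = \int[lebesgue_measure]_(r in `[0, s]) D r,
        {within `[0, T], continuous F}
      & forall s, s \in `]0, T[ -> is_derive s 1 F (D s)].
  eexists; split=> [s||s sT]; first reflexivity.
    exact: (parameterized_integral_continuous (ltW T0) iD).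
  have sD := within_continuous_continuous T0 cD sT.
  move: sT; rewrite in_itv/= => /andP[s0 sT].
  have [dF F'] := continuous_FTC1_closed sT iD s0 sD.
  by rewrite derive1E in F'; exact: DeriveDef dF F'.
rewrite -FE; pose H s := g s + C * F s.
have dH s : s \in `]0, T[ -> exists2 d, is_derive s 1 H d & d <= 0.
  move=> sT; have [d gd dD] := dg s sT.
  exists (d + C * D s); last by rewrite -lerBrDr sub0r.
  exact: is_deriveD gd (is_deriveZ C (dF s sT)).
have -> : g 0 = H 0 by rewrite /H FE set_itv1 Rintegral_set1 mulr0 addr0.
apply: (@ler0_derive1_nincr _ H 0 T) => // [s sT|s sT||].
- by have [d []] := dH s sT.
- by have [d [_ Hd] d0] := dH s sT; rewrite derive1E Hd.
- move=> s; apply: cvgD; first exact: cg.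
  by apply: cvgM; [exact: cvg_cst|exact: cF].
- exact: ltW.
Qed.

(** Gronwall's inequality with zero initial value: [g] times [expR (- C * s)] is nonincreasing,
    starts at 0 and stays nonnegative. *)
Lemma gronwall_eq0 g C T :
  {within `[0, T], continuous g} -> (forall t, 0 <= g t) -> g 0 = 0 ->
  (forall t, t \in `]0, T[ -> exists2 d, is_derive t 1 g d & d <= C * g t) ->
  forall t, t \in `[0, T] -> g t = 0.
Proof.
move=> cg g_ge0 g0 dg t; rewrite in_itv/= => /andP[t0 tT].
pose e (s : R) : R := expR (- C * s); pose H s := g s * e s.
have de (s : R) : is_derive s 1 e (- C * e s).
  have h : is_derive s 1 (fun s : R => - C * s) (- C).
    by rewrite -[X in is_derive _ _ _ X]mulr1; exact: is_deriveZ.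
  have := is_derive1_comp (is_derive_expR (- C * s)) h.
  by rewrite mulrC.
have dH s : s \in `]0, T[ -> exists2 d, is_derive s 1 H d & d <= 0.
  move=> sT; have [d gd dD] := dg s sT.
  exists (g s *: (- C * e s) + e s *: d); first exact: is_deriveM.
  have : 0 < e s by exact: expR_gt0.
  by rewrite /GRing.scale/=; nra.
have : H t <= H 0.
  apply: (@ler0_derive1_nincr _ H 0 T) => // [s sT|s sT|].
  - by have [d []] := dH s sT.
  - by have [d [_ Hd] d0] := dH s sT; rewrite derive1E Hd.
  - move=> s; apply: cvgM; first exact: cg.
    apply: continuous_subspaceT => r; apply: differentiable_continuous.
    by apply/derivable1_diffP; case: (de r).
rewrite /H g0 mul0r pmulr_lle0 ?expR_gt0// => gt0.
by apply/eqP; rewrite eq_le gt0 g_ge0.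
Qed.
End RealAnalysis.

(** * Integrals of polynomials and inverse inequalities *)

Section PolyIntegral.
Variable R : realType.
Implicit Types (a b x : R) (p q : {poly R}).

Lemma within_continuous_horner (A : set R) p :
  {within A, continuous (horner p)}.
Proof. exact/continuous_subspaceT/continuous_horner. Qed.

Definition pint a b p : R := \int[lebesgue_measure]_(x in `[a, b]) p.[x].

Lemma integrable_horner a b p :
  lebesgue_measure.-integrable `[a, b] (EFin \o horner p).
Proof. exact/integrable_itvcc/within_continuous_horner. Qed.

(** Integrability is discharged here once; the linear instance then allows purely algebraic
    rewriting under the integral. *)
Fact pint_is_scalar a b : scalar (pint a b).
Proof.
move=> c p q; rewrite /pint.
under eq_Rintegral do rewrite hornerD hornerZ.
rewrite RintegralD ?RintegralZl//; try exact: integrable_horner.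
have := @integrable_horner a b (c *: p).
by under [_ \o _]funext do rewrite /= hornerZ.
Qed.

HB.instance Definition _ a b :=
  GRing.isLinear.Build R {poly R} R *%R (pint a b) (pint_is_scalar a b).

Lemma pint_deriv a b p : a < b -> pint a b p^`() = p.[b] - p.[a].
Proof.
move=> ab; rewrite /pint /Rintegral (@continuous_FTC2 _ _ (horner p))//.
- exact: within_continuous_horner.
- split=> [x _||].
  + exact: derivable_horner.
  + exact/cvg_at_right_filter/continuous_horner.
  + exact/cvg_at_left_filter/continuous_horner.
- by move=> x _; rewrite derivE.
Qed.

Lemma pint_sqr_ge0 a b p : 0 <= pint a b (p * p).
Proof. by apply: Rintegral_ge0 => x _; rewrite hornerM -expr2 sqr_ge0. Qed.

Lemma deriv_surj p : exists P : {poly R}, P^`() = p.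
Proof.
exists (\poly_(i < (size p).+1) (p`_i.-1 / i%:R)); apply/polyP => i.
rewrite coef_deriv coef_poly ltnS /=.
case: ltnP => [ip|pi]; last by rewrite mul0rn nth_default.
by rewrite -[_ *+ _]mulr_natr -mulrA mulVf ?mulr1// pnatr_eq0.
Qed.

(** The points [a + (b - a) / i.+1] with [i < size p] are distinct roots in the interval, too many
    for a nonzero polynomial. *)
Lemma horner_itv_eq0 a b p :
  a < b -> {in `[a, b], forall x, p.[x] = 0} -> p = 0.
Proof.
move=> ab p0; pose f (i : nat) := a + (b - a) / i.+1%:R.
apply: (@roots_geq_poly_eq0 _ _ (mkseq f (size p))).
- apply/allP => _ /mapP[i _ ->]; apply/rootP/p0; rewrite in_itv/= /f.
  have i0 : (0 : R) < i.+1%:R by rewrite ltr0n.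
  have i1 : (1 : R) <= i.+1%:R by rewrite ler1n.
  rewrite lerDl divr_ge0 ?subr_ge0 ?(ltW ab) ?ler0n//=.
  by rewrite -lerBrDl ler_pdivrMr// ler_peMr// subr_ge0 ltW.
- rewrite map_inj_uniq ?iota_uniq// => i j /addrI.
  move=> /(@mulfI _ (b - a)) -/(_ _)/invr_inj.
  rewrite subr_eq0 gt_eqF// => /(_ isT)/eqP.
  by rewrite eqr_nat eqSS => /eqP.
- by rewrite size_mkseq.
Qed.

(** An antiderivative of [p * p] is nondecreasing with equal values at [a] and [b], hence constant
    on the interval, hence a constant polynomial, and its derivative [p * p] vanishes. *)
Lemma pint_sqr_eq0 a b p : a < b -> pint a b (p * p) = 0 -> p = 0.
Proof.
move=> ab; have [P dP] := deriv_surj (p * p).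
have Pmono x y : x <= y -> P.[x] <= P.[y].
  rewrite le_eqVlt => /predU1P[->//|xy].
  by rewrite -subr_ge0 -pint_deriv// dP pint_sqr_ge0.
rewrite -dP pint_deriv// => /eqP; rewrite subr_eq0 => /eqP Pab.
have P0 : P - P.[a]%:P = 0.
  apply: (horner_itv_eq0 ab) => x; rewrite in_itv/= => /andP[ax xb].
  rewrite hornerD hornerN hornerC; apply/eqP; rewrite subr_eq0 eq_le.
  by rewrite (Pmono a)// -Pab Pmono.
apply/eqP; rewrite -sqrf_eq0 expr2 -dP.
by rewrite -[P](subrK P.[a]%:P) P0 add0r derivC.
Qed.

Lemma poly_sum_coef N p : (size p <= N)%N -> p = \sum_(i < N) p`_i *: 'X^i.
Proof.
move=> pN; rewrite -poly_def; apply/polyP => i; rewrite coef_poly.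
by case: ltnP => // Ni; rewrite nth_default// (leq_trans pN).
Qed.

(* Riesz representation of the functional p |-> p`_i: the Gram matrix of the
   monomials is invertible. *)
Lemma coef_pint a b N (i : 'I_N) : a < b ->
  exists r : {poly R}, forall p, (size p <= N)%N -> p`_i = pint a b (r * p).
Proof.
move=> ab; pose G : 'M[R]_N := \matrix_(m, l) pint a b ('X^m * 'X^l).
have Gp (c : 'rV[R]_N) (l : 'I_N) : (c *m G) 0 l = pint a b (rVpoly c * 'X^l).
  rewrite mxE (poly_sum_coef (size_poly _ _ : (size (rVpoly c) <= N)%N)).
  rewrite big_distrl linear_sum/=; apply: eq_bigr => m _.
  by rewrite mxE -scalerAl linearZ coef_rVpoly_ord.
(* A kernel vector is a polynomial orthogonal to every monomial of degree below [N], hence to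
   itself, hence zero. *)
have uG : G \in unitmx.
  rewrite -row_free_unit; apply/inj_row_free => c cG.
  apply: (can_inj rVpolyK); rewrite linear0; apply: (pint_sqr_eq0 ab).
  rewrite [X in _ * X](@poly_sum_coef N) ?size_poly// big_distrr linear_sum.
  rewrite big1//= => l _.
  by rewrite -scalerAr linearZ/= -Gp cG mxE mulr0.
exists (rVpoly (row i (invmx G))) => p pN.
rewrite [in RHS](poly_sum_coef pN) big_distrr linear_sum (bigD1 i)//=.
have E (l : 'I_N) : pint a b (rVpoly (row i (invmx G)) * 'X^l) = (i == l)%:R.
  by rewrite -Gp -row_mul mulVmx// !mxE.
rewrite -scalerAr linearZ/= E eqxx mulr1 big1 ?addr0// => l li.
by rewrite -scalerAr linearZ/= E eq_sym (negbTE li) mulr0.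
Qed.

(** With [f] the identity or the derivative, this reduces the time regularity of such integrals to
    that of the coefficients, the integrals on the right being fixed. *)
Lemma pint_coefM a b N (f : {linear {poly R} -> {poly R}}) (p q : {poly R}) :
  (size p <= N)%N -> (size q <= N)%N ->
  pint a b (f p * f q) =
  \sum_(m < N) \sum_(l < N) p`_m * q`_l * pint a b (f 'X^m * f 'X^l).
Proof.
move=> pN qN; rewrite {1}(poly_sum_coef pN) {1}(poly_sum_coef qN) !linear_sum/=.
rewrite big_distrl linear_sum/=; apply: eq_bigr => m _.
rewrite big_distrr linear_sum/=; apply: eq_bigr => l _.
by rewrite !linearZ/= -scalerAl -scalerAr !linearZ/= mulrA.
Qed.

(** Cauchy-Schwarz, from the square of [p - (y / (S + 1)) *: r]. Using [S + 1] in place of [S]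
    avoids dividing by zero when [r] is zero. *)
Lemma pint_sqr_le a b (r p : {poly R}) :
  pint a b (r * p) ^+ 2 <= (pint a b (r * r) + 1) * pint a b (p * p).
Proof.
set y := pint a b (r * p); set S := pint a b (r * r).
have S1 : 0 < S + 1 by rewrite ltr_wpDl// pint_sqr_ge0.
have := pint_sqr_ge0 a b (p - (y / (S + 1)) *: r).
have -> : (p - (y / (S + 1)) *: r) * (p - (y / (S + 1)) *: r) =
    p * p + (- 2 * (y / (S + 1))) *: (r * p) + (y / (S + 1)) ^+ 2 *: (r * r).
  by rewrite -!mul_polyC !polyCM; ring.
rewrite !linearD !linearZ/= -/y -/S => h.
set w := y / (S + 1) in h *; have yw : y = w * (S + 1) by rewrite divfK ?gt_eqF.
rewrite yw in h *.
have -> : (w * (S + 1)) ^+ 2 = (S + 1) * (w ^+ 2 * (S + 1)) by ring.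
rewrite ler_pM2l//; have := sqr_ge0 w; lra.
Qed.

(** Each coefficient is an inner product with a fixed Riesz representative, so Cauchy-Schwarz bounds
    it by the L2 norm of [p]; each [e i] is bounded on the interval. The family [e] encodes the
    linear operator sending ['X^i] to [e i]. *)
Lemma pint_bound a b N (e : nat -> {poly R}) : a < b ->
  exists2 C, 0 <= C & forall p, (size p <= N)%N -> forall x, x \in `[a, b] ->
    `|(\sum_(i < N) p`_i *: e i).[x]| <= C * Num.sqrt (pint a b (p * p)).
Proof.
move=> ab; have /fin_all_exists[r Hr] := fun i : 'I_N => coef_pint i ab.
pose ub i := sval (poly_itv_bound (e i) a b).
exists (\sum_i Num.sqrt (pint a b (r i * r i) + 1) * `|ub i|).
  by apply: sumr_ge0 => i _; rewrite mulr_ge0.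
move=> p pN x xab; rewrite horner_sum mulr_suml.
apply: le_trans (ler_norm_sum _ _ _) _; apply: ler_sum => i _.
rewrite hornerZ normrM mulrAC; apply: ler_pM => //; last first.
  apply: le_trans (ler_norm _).
  rewrite /ub; case: poly_itv_bound => /= B; apply.
  by rewrite in_itv in xab.
rewrite -sqrtrM ?addr_ge0 ?pint_sqr_ge0// -sqrtr_sqr ler_wsqrtr//.
by rewrite (Hr i)// pint_sqr_le.
Qed.

(** Two instances of the previous bound: the monomials for the values of [p], their derivatives for
    the values of its derivative. The two constants are added to serve both. *)
Lemma pint_inverse a b N : a < b ->
  exists2 C, 0 <= C & forall p, (size p <= N)%N -> forall x, x \in `[a, b] ->
    `|p.[x]| <= C * Num.sqrt (pint a b (p * p)) /\
    `|p^`().[x]| <= C * Num.sqrt (pint a b (p * p)).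
Proof.
move=> ab; have [C C0 HC] := pint_bound N (fun i => 'X^i) ab.
have [D D0 HD] := pint_bound N (fun i => 'X^i^`()) ab.
exists (C + D); first exact: addr_ge0.
move=> p pN x xab; split.
  rewrite {1}(poly_sum_coef pN); apply: le_trans (HC _ pN _ xab) _.
  by rewrite ler_wpM2r// lerDl.
rewrite {1}(poly_sum_coef pN) linear_sum/=.
under eq_bigr do rewrite linearZ/=.
apply: le_trans (HD _ pN _ xab) _.
by rewrite ler_wpM2r// lerDr.
Qed.

Lemma norm_pint a b p B : a <= b -> {in `[a, b], forall x, `|p.[x]| <= B} ->
  `|pint a b p| <= B * (b - a).
Proof.
move=> ab pB; rewrite /pint.
apply: le_trans (le_normr_Rintegral _ (integrable_horner _ _ _)) _ => //.
apply: le_trans (le_Rintegral (f2 := cst B) _ _ _ _) _ => //.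
- apply/integrable_itvcc/continuous_subspaceT => x.
  by apply: cvg_comp; [exact: continuous_horner|exact: norm_continuous].
- by apply/integrable_itvcc/continuous_subspaceT/cst_continuous.
- rewrite Rintegral_cst//= lebesgue_measure_itv/= lte_fin.
  by case: ltgtP ab => // ->; rewrite ?subrr ?mulr0.
Qed.
End PolyIntegral.

(** * Mesh integrals and regrouping of element boundaries by faces *)

Section Mesh.
Variables (R : realType) (n : nat) (M : mesh R n) (bc : bcond).
Implicit Types (j : 'I_n.+1) (i : 'I_n.+2) (F G : 'I_n.+1 -> {poly R}).

Lemma node_lt j : node M (vtx j false) < node M (vtx j true).
Proof. by apply: node_incr; rewrite lift_max lift0. Qed.

Lemma meshsize_gt0 : 0 < meshsize M.
Proof.
rewrite /meshsize (bigD1 ord0)//= lt_max; apply/orP; left.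
by rewrite subr_gt0 node_lt.
Qed.

Lemma vtx_itv j s :
  node M (vtx j s) \in `[node M (vtx j false), node M (vtx j true)].
Proof. by rewrite in_itv/=; case: s; rewrite lexx ltW// node_lt. Qed.

Definition mint F : R :=
  \sum_j pint (node M (vtx j false)) (node M (vtx j true)) (F j).

Lemma ipK_horner F G :
  ipK M (fun j => horner (F j)) (fun j => horner (G j)) =
  mint (fun j => F j * G j).
Proof.
by apply: eq_bigr => j _; apply: eq_Rintegral => x _; rewrite hornerM.
Qed.

Lemma mintD F G : mint (fun j => F j + G j) = mint F + mint G.
Proof. by rewrite /mint -big_split; apply: eq_bigr => j _; rewrite linearD. Qed.

Lemma mintZ c F : mint (fun j => c *: F j) = c * mint F.
Proof. by rewrite /mint big_distrr; apply: eq_bigr => j _; rewrite linearZ. Qed.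

Lemma mintB F G : mint (fun j => F j - G j) = mint F - mint G.
Proof. by rewrite /mint -sumrB; apply: eq_bigr => j _; rewrite raddfB. Qed.

Lemma mint_sqr_ge0 F : 0 <= mint (fun j => F j * F j).
Proof. by apply: sumr_ge0 => j _; exact: pint_sqr_ge0. Qed.

Lemma pint_le_mint F j :
  pint (node M (vtx j false)) (node M (vtx j true)) (F j * F j) <=
  mint (fun j => F j * F j).
Proof.
rewrite /mint (bigD1 j)//= lerDl.
by apply: sumr_ge0 => l _; exact: pint_sqr_ge0.
Qed.

Lemma mint_sqr_eq0 F : mint (fun j => F j * F j) = 0 -> forall j, F j = 0.
Proof.
move=> F0 j; apply: (pint_sqr_eq0 (node_lt j)); apply: le_anti.
by rewrite pint_sqr_ge0 andbT -F0 pint_le_mint.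
Qed.

Lemma eltL_lift j : eltL bc (lift ord0 j) = Some j.
Proof. by rewrite /eltL liftK. Qed.

Lemma eltR_lift j : eltR bc (lift ord_max j) = Some j.
Proof. by rewrite /eltR liftK. Qed.

Lemma sum_ord_max (G : 'I_n.+2 -> R) :
  \sum_i G i = G ord_max + \sum_j G (lift ord_max j).
Proof. exact: (bigD1_ord ord_max). Qed.

(** Each counted face is the right endpoint of exactly one element, except the first node under
    Dirichlet conditions. *)
Lemma face_sumL (G : 'I_n.+2 -> R) : (bc = Dirichlet -> G ord0 = 0) ->
  \sum_(i | face bc i) G i = \sum_j G (lift ord0 j).
Proof.
rewrite /face; case: bc => [/(_ erefl) G0|_].
  by rewrite big_ord_recl G0 add0r.
by rewrite big_mkcond big_ord_recl/= add0r.
Qed.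

(** Mirror image for left endpoints. Under periodic conditions the counted face [ord_max] has to
    stand for [ord0], the left endpoint of the first element. *)
Lemma face_sumR (G : 'I_n.+2 -> R) : (bc = Dirichlet -> G ord_max = 0) ->
  (bc = Periodic -> G ord0 = G ord_max) ->
  \sum_(i | face bc i) G i = \sum_j G (lift ord_max j).
Proof.
rewrite /face; case: bc => [/(_ erefl) G0 _|_ /(_ erefl) G0].
  by rewrite sum_ord_max G0 add0r.
by have := sum_ord_max G; rewrite (bigD1 ord0)//= -G0 => /addrI.
Qed.

(** A single-valued flux meets the left trace with sign 1 and the right trace with sign -1. The two
    halves of the jump are summed separately, one over right endpoints of elements and one over left
    endpoints; absent traces count as 0. *)
Lemma ipB_face (F : 'I_n.+2 -> R) (f : broken R n) :
  (bc = Periodic -> F ord0 = F ord_max) ->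
  ipB (fun j s => nrm R s * of_face F j s) (tr M f) =
  \sum_(i | face bc i) F i * jump M bc f i.
Proof.
move=> Fper.
pose l i := odflt 0 (trL M bc f i); pose r i := odflt 0 (trR M bc f i).
transitivity (\sum_(i | face bc i) F i * l i - \sum_(i | face bc i) F i * r i).
  rewrite face_sumL; last first.
    by rewrite /l /trL /eltL unlift_none => ->; rewrite mulr0.
  rewrite face_sumR; first last.
  - move=> bcP; rewrite Fper// /r /trR /eltR unlift_none bcP.
    have -> : ord0 = lift ord_max ord0 :> 'I_n.+2 by apply/val_inj.
    by rewrite liftK.
  - by rewrite /r /trR /eltR unlift_none => ->; rewrite mulr0.
  rewrite -sumrB; apply: eq_bigr => j _.
  rewrite big_bool /l /r /trL /trR eltL_lift eltR_lift /= /of_face /tr.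
  by rewrite /vtx mul1r mulN1r mulNr.
rewrite -sumrB; apply: eq_bigr => i _.
by rewrite /jump /nrm mulr1 mulrN1 mulrBr.
Qed.

(** A face is an endpoint of at most two elements, once as a right and once as a left endpoint. In
    the periodic case both end nodes are charged to [ord_max]. *)
Lemma sum_nodes_le (G : 'I_n.+2 -> R) : (forall i, 0 <= G i) ->
  (bc = Periodic -> G ord0 = G ord_max) ->
  \sum_j \sum_(s : bool) G (vtx j s) <= 2 * \sum_(i | face bc i) G i.
Proof.
move=> G0 Gper; under eq_bigr do rewrite big_bool/=.
rewrite big_split/= mulr2n mulrDl mul1r.
apply: lerD.
  rewrite /face; case: bc => //.
    by rewrite [leRHS]big_ord_recl/= lerDr.
  by rewrite [leRHS]big_mkcond/= [leRHS]big_ord_recl/= add0r.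
rewrite /face; case: bc Gper => [_|/(_ erefl) Gper].
  by rewrite sum_ord_max lerDr.
by have := sum_ord_max G; rewrite (bigD1 ord0)//= -Gper => /addrI <-.
Qed.
End Mesh.

(** * Cancellations in the viscous and convective terms *)

Section Space.
Variables (R : realType) (n k : nat) (M : mesh R n) (bc : bcond).
Variables (kappa sigma : R).
Implicit Types (j : 'I_n.+1) (i : 'I_n.+2) (u v q p w : Vh R n k).

Local Notation poly v := (fun j => (v j : {poly R})).

Lemma elt_periodic : bc = Periodic ->
  eltL bc (@ord0 n.+1) = eltL bc ord_max /\
  eltR bc (@ord0 n.+1) = eltR bc ord_max.
Proof.
move=> bcP; split.
  rewrite [in RHS](_ : ord_max = lift ord0 ord_max); last exact/val_inj.
  by rewrite eltL_lift /eltL unlift_none bcP.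
rewrite [in LHS](_ : ord0 = lift ord_max ord0); last exact/val_inj.
by rewrite eltR_lift /eltR unlift_none bcP.
Qed.

Lemma jump_periodic (f : broken R n) : bc = Periodic ->
  jump M bc f ord0 = jump M bc f ord_max.
Proof. by move=> /elt_periodic[eL eR]; rewrite /jump /trL /trR eL eR. Qed.

Lemma uflux_periodic u : bc = Periodic ->
  uflux M bc u ord0 = uflux M bc u ord_max.
Proof.
move=> /elt_periodic[eL eR].
by rewrite /uflux /boundary_face /avg /trL /trR eL eR.
Qed.

Lemma qflux_periodic q : bc = Periodic ->
  qflux M bc q ord0 = qflux M bc q ord_max.
Proof. by move=> /elt_periodic[eL eR]; rewrite /qflux /avg /trL /trR eL eR. Qed.

Lemma entropy_flux_periodic u : bc = Periodic ->
  entropy_flux M bc sigma u ord0 = entropy_flux M bc sigma u ord_max.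
Proof.
move=> bcP; rewrite /entropy_flux jump_periodic//.
by have [eL eR] := elt_periodic bcP; rewrite /avg0 /trL /trR eL eR.
Qed.

Lemma sum_jump (f : broken R n) :
  \sum_(i | face bc i) jump M bc f i =
  \sum_j (f j (node M (vtx j true)) - f j (node M (vtx j false))).
Proof.
under eq_bigr do rewrite -[jump _ _ _ _]mul1r.
rewrite -(@ipB_face _ _ _ _ (fun=> 1))//; apply: eq_bigr => j _.
by rewrite big_bool/= /of_face /tr !mulr1 mul1r mulN1r.
Qed.

(** The flux [u**] is single-valued and regroups by faces; the interior trace of [u] is not, and
    contributes the jump of the product of [u] and [p] instead. *)
Lemma gradient_eqE u q p : gradient_eq M bc u q ->
  mint M (fun j => (q j : {poly R}) * p j) =
  mint M (fun j => (u j : {poly R})^`() * p j) +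
  \sum_(i | face bc i) (uflux M bc u i * jump M bc (ev p) i
                        - jump M bc (fun j x => ev u j x * ev p j x) i).
Proof.
move=> /(_ p); rewrite (ipK_horner M (poly q) (poly p)).
rewrite (ipK_horner M (fun j => (u j : {poly R})^`()) (poly p)) => ->.
congr (_ + _).
rewrite sumrB -ipB_face; last exact: uflux_periodic.
rewrite sum_jump /ipB -sumrB; apply: eq_bigr => j _.
rewrite !big_bool/= /of_face /tr.
ring.
Qed.

(** The gradient equation is tested with [q]. On an interior face the jump of [u q] is the average
    of [u] times the jump of [q] plus the average of [q] times the jump of [u]; on a Dirichlet face
    [u**] is 0 and [q**] is the interior trace, which gives the same cancellation. *)
Lemma viscous_energy u q : gradient_eq M bc u q ->
  - mint M (fun j => (q j : {poly R}) * (u j : {poly R})^`()) +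
  \sum_(i | face bc i) qflux M bc q i * jump M bc (ev u) i =
  - mint M (fun j => (q j : {poly R}) * q j).
Proof.
move=> uq; rewrite (gradient_eqE q uq) opprD.
congr (_ + _).
  by congr (- _); apply: eq_bigr => j _; rewrite mulrC.
rewrite -sumrN; apply: eq_bigr => i _.
rewrite /uflux /qflux /jump /avg /boundary_face /trL /trR /nrm.
case: (eltL bc i) => [l|]; case: (eltR bc i) => [r|] //=; by field.
Qed.

(** In an element the integrand is the derivative of [u ^+ 3 / 6]. On a face with traces [a] and [b]
    the flux without its [sigma] term is [(a ^+ 2 + a * b + b ^+ 2) / 6], whose product with [a - b]
    is exactly the jump of [u ^+ 3 / 6]. The exterior trace 0 in [avg0] preserves this at Dirichlet
    faces. *)
Lemma entropy_energy u :
  mint M (fun j => (2^-1 *: (u j : {poly R}) ^+ 2) * (u j : {poly R})^`()) -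
  \sum_(i | face bc i) entropy_flux M bc sigma u i * jump M bc (ev u) i =
  - (sigma / meshsize M * ipE bc (jump M bc (ev u)) (jump M bc (ev u))).
Proof.
have -> :
    mint M (fun j => (2^-1 *: (u j : {poly R}) ^+ 2) * (u j : {poly R})^`()) =
    \sum_(i | face bc i) jump M bc (fun j x => 6^-1 * ev u j x ^+ 3) i.
  rewrite sum_jump; apply: eq_bigr => j _.
  have -> : 2^-1 *: (u j : {poly R}) ^+ 2 * (u j : {poly R})^`() =
            (6^-1 *: (u j : {poly R}) ^+ 3)^`().
    rewrite derivZ deriv_exp -[(_ * _) *+ _]scaler_nat scalerA mulrC -scalerAr.
    by congr (_ *: _); field.
  by rewrite pint_deriv ?node_lt// !hornerZ !horner_exp.
rewrite /ipE big_distrr -sumrB -sumrN /=; apply: eq_bigr => i _.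
rewrite /entropy_flux /jump /avg0 /trL /trR /nrm.
have h0 := gt_eqF (meshsize_gt0 M).
case: (eltL bc i) => [l|]; case: (eltR bc i) => [r|] //=; by field; rewrite h0.
Qed.

(** The terms in [ut] cancel between [Lform] and [Nform], in the volume and in the fluxes, leaving
    polynomial integrals and face sums. *)
Lemma evolution_eqE (ut : broken R n) u q w v :
  (forall j, {within elt M j, continuous (ut j)}) ->
  evolution_eq M bc kappa sigma ut u q w ->
  mint M (fun j => (w j : {poly R}) * v j) =
  - (kappa * mint M (fun j => (q j : {poly R}) * (v j : {poly R})^`()))
  + mint M (fun j => (2^-1 *: (u j : {poly R}) ^+ 2) * (v j : {poly R})^`())
  + \sum_(i | face bc i) (kappa * qflux M bc q i - entropy_flux M bc sigma u i)
      * jump M bc (ev v) i.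
Proof.
move=> utc /(_ v); rewrite (ipK_horner M (poly w) (poly v)) => ->.
rewrite /Lform /Nform addrACA; congr (_ + _); last first.
  rewrite -ipB_face; last first.
    by move=> ?; rewrite qflux_periodic// entropy_flux_periodic.
  rewrite /ipB -big_split; apply: eq_bigr => j _.
  rewrite !big_bool/= /of_face /tr.
  ring.
apply: oppr_inj; rewrite !opprD !opprK -mintZ -mintB.
rewrite /ipK -big_split; apply: eq_bigr => j _ /=.
have cev (c : {poly R}) : {within elt M j, continuous (fun x => c.[x])}.
  exact: within_continuous_horner.
have cu2 : {within elt M j, continuous (fun x => 2^-1 * ev u j x ^+ 2)}.
  apply: within_continuousM; first exact: within_continuous_cst.
  by apply: within_continuousM; exact: cev.
have cq : {within elt M j, continuous (fun x => kappa * ev q j x)}.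
  by apply: within_continuousM; [exact: within_continuous_cst|exact: cev].
have cut : {within elt M j, continuous (fun x => ut j x * ev u j x)}.
  by apply: within_continuousM => //; exact: cev.
(* The two volume integrals are merged so that [ut] cancels pointwise; continuity of [ut] on the
   closed element supplies the integrability. *)
rewrite -RintegralD//=; first 1 last.
- exact: measurable_itv.
- apply/integrable_itvcc/(within_continuousM (within_continuousB cq cut)).
  exact: cev.
- apply/integrable_itvcc/(within_continuousM (within_continuousB cut cu2)).
  exact: cev.
apply: eq_Rintegral => x _.
rewrite hornerD hornerN !hornerM !hornerZ hornerM horner_exp /ev /dx; ring.
Qed.
End Space.

(** * Energy identity and control of the derivative by [q] and the jumps *)

Section Estimates.
Variables (R : realType) (n k : nat) (M : mesh R n) (bc : bcond).
Variables (kappa sigma : R).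
Implicit Types (j : 'I_n.+1) (i : 'I_n.+2) (u v q p w : Vh R n k).

Lemma L2sqE u : L2sq M (ev u) = mint M (fun j => (u j : {poly R}) * u j).
Proof. by pose p j := u j : {poly R}; exact: (ipK_horner M p p). Qed.

Lemma L2sq_dxE u :
  L2sq M (dx u) = mint M (fun j => (u j : {poly R})^`() * (u j : {poly R})^`()).
Proof. by pose du j := (u j : {poly R})^`(); exact: (ipK_horner M du du). Qed.

Lemma energy_identity (ut : broken R n) u q w :
  (forall j, {within elt M j, continuous (ut j)}) ->
  gradient_eq M bc u q -> evolution_eq M bc kappa sigma ut u q w ->
  mint M (fun j => (w j : {poly R}) * u j) =
  - (kappa * mint M (fun j => (q j : {poly R}) * q j)
     + sigma / meshsize M * ipE bc (jump M bc (ev u)) (jump M bc (ev u))).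
Proof.
move=> utc uq /(evolution_eqE u utc) ->.
rewrite opprD -entropy_energy -[X in _ = X + _]mulrN.
rewrite -(viscous_energy uq).
under eq_bigr do rewrite mulrBl -mulrA.
by rewrite sumrB -big_distrr /=; ring.
Qed.

(** The sum of the nonnegative element constants dominates each of them. *)
Lemma mesh_inverse N : exists2 K, 0 <= K & forall j (p : {poly R}) x,
  (size p <= N)%N -> x \in `[node M (vtx j false), node M (vtx j true)] ->
  let D :=
    Num.sqrt (pint (node M (vtx j false)) (node M (vtx j true)) (p * p)) in
  `|p.[x]| <= K * D /\ `|p^`().[x]| <= K * D.
Proof.
have /fin_all_exists2[K K0 HK] := fun j => pint_inverse N (node_lt M j).
exists (\sum_j K j) => [|j p x pN xj D]; first exact: sumr_ge0.
have KD : K j * D <= (\sum_j K j) * D.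
  by rewrite ler_wpM2r ?sqrtr_ge0// (bigD1 j)//= lerDl sumr_ge0.
by have [h1 h2] := HK j p pN x xj; split; apply: le_trans KD.
Qed.

(** On an interior face the difference is half the jump up to sign; on a Dirichlet face it is minus
    the trace, and the jump is the trace up to sign. *)
Lemma uflux_sub_le_jump u j s :
  (uflux M bc u (vtx j s) - tr M (ev u) j s) ^+ 2 <=
  jump M bc (ev u) (vtx j s) ^+ 2.
Proof.
rewrite /uflux /jump /avg /boundary_face /trL /trR /nrm /tr.
case: s => /=; rewrite ?eltL_lift ?eltR_lift/=.
  case: (eltR bc _) => [r|] /=; last by rewrite mul0r addr0 sub0r sqrrN mulr1.
  set a := ev u j _; set b := ev u r _; have := sqr_ge0 (a - b); nra.
case: (eltL bc _) => [r|] /=; last by rewrite mul0r !add0r mulrN1.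
set a := ev u j _; set b := ev u r _; have := sqr_ge0 (a - b); nra.
Qed.

(** Testing with the derivative gives [X = Y - B]. The bounds [Y <= Q + X / 4] and
    [- B <= 2 * L * J + X / 2] leave a quarter of [X], whence the constants 4 and [8 * L]. *)
Lemma dx_le_gradient : exists2 A, 0 <= A & forall u q, gradient_eq M bc u q ->
  L2sq M (dx u) <= 4 * mint M (fun j => (q j : {poly R}) * q j)
                   + A * ipE bc (jump M bc (ev u)) (jump M bc (ev u)).
Proof.
(* The added 1 makes [L] positive, as it serves as a weight in Young's inequality. *)
have [K K0 HK] := mesh_inverse k.+1; pose L := K ^+ 2 + 1.
have L0 : 0 < L by rewrite ltr_wpDl// sqr_ge0.
exists (8 * L) => [|u q uq]; first by rewrite mulr_ge0// ltW.
have du_size j : (size (u j : {poly R})^`() <= k.+1)%N.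
  exact: leq_trans (size_poly _ _) (leq_trans (leq_pred _) (size_npoly _)).
pose d : Vh R n k := fun j => npolyp k.+1 (u j : {poly R})^`().
have dE j : d j = (u j : {poly R})^`() :> {poly R} by exact: npolypK.
have := uq d.
rewrite (ipK_horner M (fun j => q j : {poly R}) (fun j => d j : {poly R})).
rewrite (ipK_horner M (fun j => (u j : {poly R})^`())
  (fun j => d j : {poly R})).
have intE (F : 'I_n.+1 -> {poly R}) :
    mint M (fun j => F j * d j) = mint M (fun j => F j * (u j : {poly R})^`()).
  by apply: eq_bigr => j _; rewrite dE.
rewrite (intE (fun j => q j : {poly R})) (intE (fun j => (u j : {poly R})^`())).
rewrite -L2sq_dxE.
set X := L2sq M (dx u); set Y := mint M _; set B := ipB _ _ => XE.
set Q := mint M _; set J := ipE _ _ _.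
have YQ : Y <= Q + X / 4.
  (* Young's inequality, from the square of [2 q - u_x]. *)
  have := mint_sqr_ge0 M
    (fun j => (q j : {poly R}) *+ 2 - (u j : {poly R})^`()).
  rewrite (_ : (fun j => _) = fun j => 4 *: ((q j : {poly R}) * q j -
      (q j : {poly R}) * (u j : {poly R})^`()) +
      (u j : {poly R})^`() * (u j : {poly R})^`()).
    by rewrite mintD mintZ mintB -L2sq_dxE -/X -/Y -/Q; lra.
  by apply/funext => j; rewrite scaler_nat; ring.
have BJ : - B <= L * (2 * J) + X / 2.
  have nodes : \sum_j \sum_(s : bool) jump M bc (ev u) (vtx j s) ^+ 2 <= 2 * J.
    have -> : J = \sum_(i | face bc i) jump M bc (ev u) i ^+ 2 by [].
    apply: sum_nodes_le => [i|bcP]; first exact: sqr_ge0.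
    by rewrite (jump_periodic _ _ bcP).
  apply: le_trans (_ : L * (\sum_j \sum_(s : bool)
    jump M bc (ev u) (vtx j s) ^+ 2) + X / 2 <= _); last first.
    by rewrite lerD2r ler_pM2l.
  rewrite /X L2sq_dxE mulr_sumr mulr_suml -big_split /= -sumrN.
  apply: ler_sum => j _.
  rewrite !sumr_bool; set P := pint _ _ _.
  have P0 : 0 <= P by exact: pint_sqr_ge0.
  have side s : - (nrm R s * (of_face (uflux M bc u) j s - tr M (ev u) j s) *
      tr M (ev d) j s) <= L * jump M bc (ev u) (vtx j s) ^+ 2 + P / 4.
    have := uflux_sub_le_jump u j s; rewrite /of_face.
    set a := _ - _; set c := jump _ _ _ _ => ac.
    have [+ _] := HK j _ _ (du_size j) (vtx_itv M j s).
    rewrite /tr /ev dE; set b := _.[_] => bP.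
    have b2 : b ^+ 2 <= L * P.
      have : `|b| ^+ 2 <= (K * Num.sqrt P) ^+ 2.
        by rewrite lerXn2r// ?nnegrE// mulr_ge0// sqrtr_ge0.
      rewrite real_normK ?num_real// exprMn sqr_sqrtr// /L mulrDl mul1r => h.
      by rewrite ler_wpDr.
    have L2 := lt0r_neq0 L0.
    (* Young's inequality with weight L: the term in b is absorbed by P / 4. *)
    have ab t : t ^+ 2 = 1 -> - (t * a * b) <= L * a ^+ 2 + b ^+ 2 / (4 * L).
      move=> t1; have := mulr_ge0 (ltW L0) (sqr_ge0 (t * a + b / (2 * L))).
      rewrite (_ : L * (t * a + b / (2 * L)) ^+ 2 =
        t ^+ 2 * (L * a ^+ 2) + t * a * b + b ^+ 2 / (4 * L)); last by field.
      by rewrite t1; lra.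
    have : b ^+ 2 / (4 * L) <= P / 4.
      have -> : P / 4 = L * P / (4 * L) by field.
      by rewrite ler_pM2r// invr_gt0 mulr_gt0.
    have /ab : nrm R s ^+ 2 = 1.
      by rewrite /nrm; case: (s); rewrite ?sqrrN expr1n.
    by have := ler_wpM2l (ltW L0) ac; lra.
  by have := side true; have := side false; lra.
have -> : 8 * L * J = 4 * (L * (2 * J)) by ring.
lra.
Qed.
End Estimates.

(** * Time regularity of the norms *)

Section Time.
Variables (R : realType) (n k : nat) (M : mesh R n) (bc : bcond).
Implicit Types (j : 'I_n.+1) (u : R -> Vh R n k) (A : set R).

Lemma is_derive_mint_sqr u (t : R) (w : Vh R n k) : is_dt u t w ->
  is_derive t 1 (fun s => mint M (fun j => (u s j : {poly R}) * u s j))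
    (2 * mint M (fun j => (w j : {poly R}) * u t j)).
Proof.
move=> du; rewrite /mint mulr_sumr; apply: is_derive_fsum => j.
set a := node _ _; set b := node _ _.
have E := fun p q : {poly_k.+1 R} =>
  @pint_coefM R a b k.+1 idfun p q (size_npoly p) (size_npoly q).
rewrite (_ : (fun s => _) = fun s => \sum_(m < k.+1) \sum_(l < k.+1)
    (u s j : {poly R})`_m * (u s j : {poly R})`_l *
      pint a b ('X^m * 'X^l)); last first.
  by apply/funext => s; rewrite (E (u s j) (u s j)).
(* The factor 2 is split into the two orders of the product, to match the product rule applied to
   each pair of coefficients. *)
rewrite (_ : 2 * _ = \sum_(m < k.+1) \sum_(l < k.+1)
    ((u t j : {poly R})`_m * (w j : {poly R})`_l +
     (u t j : {poly R})`_l * (w j : {poly R})`_m) *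
      pint a b ('X^m * 'X^l)); last first.
  rewrite mulr2n mulrDl mul1r {1}mulrC (E (u t j) (w j)) (E (w j) (u t j)).
  rewrite -big_split.
  apply: eq_bigr => m _; rewrite -big_split; apply: eq_bigr => l _ /=; ring.
apply: is_derive_fsum => m; apply: is_derive_fsum => l.
have h := is_deriveZ (pint a b ('X^m * 'X^l)) (is_deriveM (du j m) (du j l)).
rewrite (_ : (fun s => _) = pint a b ('X^m * 'X^l) \*:
  ((fun s => (u s j : {poly R})`_m) * (fun s => (u s j : {poly R})`_l))).
  by apply: is_derive_eq; rewrite /GRing.scale/= mulrC.
by apply/funext => s /=; rewrite /GRing.scale/= mulrC.
Qed.

Lemma within_continuous_pint u A j a b (f : {linear {poly R} -> {poly R}}) :
  Vh_continuous A u ->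
  {within A, continuous (fun s => pint a b (f (u s j) * f (u s j)))}.
Proof.
move=> cu.
under eq_fun do rewrite (pint_coefM _ _ _ (size_npoly _) (size_npoly _)).
apply: within_continuous_sum => m; apply: within_continuous_sum => l.
by apply/within_continuousM/within_continuous_cst; exact/within_continuousM.
Qed.

Lemma within_continuous_L2sq u A : Vh_continuous A u ->
  {within A, continuous (fun s => L2sq M (ev (u s)))}.
Proof.
move=> cu; under eq_fun do rewrite L2sqE.
apply: within_continuous_sum => j.
exact: (within_continuous_pint (f := idfun) cu).
Qed.

Lemma within_continuous_ev u A j x : Vh_continuous A u ->
  {within A, continuous (fun s => ev (u s) j x)}.
Proof.
move=> cu; rewrite /ev.
under eq_fun do rewrite (poly_sum_coef (size_npoly _)) horner_sum.
apply: within_continuous_sum => m; under eq_fun do rewrite hornerZ.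
by apply/within_continuousM/within_continuous_cst.
Qed.

Lemma within_continuous_DGsq u A : Vh_continuous A u ->
  {within A, continuous (fun s => DGsq M bc (u s))}.
Proof.
move=> cu; rewrite /DGsq.
have cJ i : {within A, continuous (fun s => jump M bc (ev (u s)) i)}.
  rewrite /jump /trL /trR.
  apply: (@within_continuousD _ _ _ _ (fun s => _) (fun s => _)).
    apply/within_continuousM/within_continuous_cst; case: eltL => [l|]/=.
      exact: within_continuous_ev.
    exact: within_continuous_cst.
  apply/within_continuousM/within_continuous_cst; case: eltR => [l|]/=.
    exact: within_continuous_ev.
  exact: within_continuous_cst.
apply: (@within_continuousD _ _ _ _ (fun s => _) (fun s => _)).
  under eq_fun do rewrite L2sq_dxE.
  apply: within_continuous_sum => j.
  exact: (within_continuous_pint (f := @deriv R) cu).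
apply: within_continuousM; first exact: within_continuous_cst.
by apply: within_continuous_sum => i; exact: within_continuousM.
Qed.
End Time.

(** * Stability, Lipschitz bounds and uniqueness *)

Section Stability.
Variables (R : realType) (n k : nat) (M : mesh R n) (bc : bcond).
Variables (kappa sigma : R) (kappa_gt0 : 0 < kappa) (sigma_ge0 : 0 <= sigma).
Implicit Types (j : 'I_n.+1) (i : 'I_n.+2).

Local Notation h := (meshsize M).

Lemma L2sq_ge0 (v : Vh R n k) : 0 <= L2sq M (ev v).
Proof. by rewrite L2sqE mint_sqr_ge0. Qed.

Lemma DGsq_ge0 (v : Vh R n k) : 0 <= DGsq M bc v.
Proof.
rewrite addr_ge0 ?L2sq_dxE ?mint_sqr_ge0// mulr_ge0//.
  by rewrite invr_ge0 ltW// meshsize_gt0.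
by apply: sumr_ge0 => i _; rewrite -expr2 sqr_ge0.
Qed.

(** The derivative part of the DG norm is paid for by [kappa] and [sigma] together, its jump part by
    the [sigma] term alone; hence positivity of [C] is tied to that of [sigma]. The constant depends
    on the mesh but not on the state. *)
Lemma dissipation : exists C, [/\ 0 <= C, 0 < sigma -> 0 < C &
  forall (ut : broken R n) (u q w : Vh R n k),
    (forall j, {within elt M j, continuous (ut j)}) ->
    gradient_eq M bc u q -> evolution_eq M bc kappa sigma ut u q w ->
    2 * mint M (fun j => (w j : {poly R}) * u j) <= - (C * DGsq M bc u)].
Proof.
have [A A0 HA] := dx_le_gradient k M bc; have h0 := meshsize_gt0 M.
have Ah0 : 0 < A * h + 1 by rewrite ltr_wpDl// mulr_ge0// ltW.
(* The first entry makes [4 * C <= 2 * kappa], which handles [Q]; the second lets [sigma] absorb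
   both jump contributions, [C * A * J] and [C * J / h]. *)
pose C := Num.min (kappa / 2) (2 * sigma / (A * h + 1)).
have C0 : 0 <= C by rewrite le_min !divr_ge0 ?mulr_ge0// ltW.
have C1 : C <= kappa / 2 by rewrite ge_min lexx.
have C2 : C * (A * h + 1) <= 2 * sigma.
  by rewrite -ler_pdivlMr// ge_min lexx orbT.
exists C; split=> // [s0|ut u q w utc uq uw].
  by rewrite lt_min !divr_gt0 ?mulr_gt0.
rewrite (energy_identity utc uq uw) /DGsq; have := HA u q uq.
set X := L2sq _ _; set Q := mint _ _; set J := ipE _ _ _ => XQJ.
have Q0 : 0 <= Q by exact: mint_sqr_ge0.
have J0 : 0 <= J by apply: sumr_ge0 => i _; rewrite -expr2 sqr_ge0.
have CX : C * X <= 2 * kappa * Q + C * A * J.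
  apply: le_trans (ler_wpM2l C0 XQJ) _.
  by rewrite mulrDr !mulrA lerD2r ler_wpM2r//; lra.
have CJ : C * A * J + C * (h^-1 * J) <= 2 * (sigma / h * J).
  have -> : C * A * J + C * (h^-1 * J) = C * (A * h + 1) * (J / h).
    by field; rewrite gt_eqF.
  have -> : 2 * (sigma / h * J) = 2 * sigma * (J / h) by ring.
  by rewrite ler_wpM2r// divr_ge0// ltW.
lra.
Qed.

Lemma stability : exists C : R, [/\ 0 <= C, 0 < sigma -> 0 < C &
  forall (ut : R -> broken R n) (T : R) (u q : R -> Vh R n k),
    reference_state M ut -> DG_solution M bc kappa sigma ut T u q ->
    forall t : R, t \in `[0, T] ->
      L2sq M (ev (u t)) +
        C * \int[lebesgue_measure]_(tau in `[0, t]) DGsq M bc (u tau)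
      <= L2sq M (ev (u 0))].
Proof.
have [C [C0 C1 HC]] := dissipation.
exists C; split=> // ut T u q utc [cu uq dtu].
apply: integral_inequality.
- exact: within_continuous_L2sq.
- exact: within_continuous_DGsq.
- move=> t tT; have [w dw uw] := dtu t tT.
  exists (2 * mint M (fun j => (w j : {poly R}) * u t j)).
    under eq_fun do rewrite L2sqE.
    exact: is_derive_mint_sqr.
  apply: HC (utc t) _ uw; apply: uq.
  exact: (subset_itv_oo_cc tT).
Qed.

(** A priori bound that makes the Lipschitz constant in the uniqueness argument uniform in time. *)
Lemma L2sq_le_initial ut T (u q : R -> Vh R n k) :
  reference_state M ut -> DG_solution M bc kappa sigma ut T u q ->
  forall t, t \in `[0, T] -> L2sq M (ev (u t)) <= L2sq M (ev (u 0)).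
Proof.
move=> utc uq t tT; have [C [C0 _ HC]] := stability.
apply: le_trans (HC ut T u q utc uq t tT); rewrite lerDl mulr_ge0//.
by apply: Rintegral_ge0 => s _; exact: DGsq_ge0.
Qed.

Definition Vsub (u v : Vh R n k) : Vh R n k := fun j => u j - v j.

Lemma VsubE u v j : Vsub u v j = (u j : {poly R}) - v j :> {poly R}.
Proof. by []. Qed.

Lemma mesh_bound : exists2 K, 0 <= K & forall (v : Vh R n k) j x,
  x \in `[node M (vtx j false), node M (vtx j true)] ->
  `|ev v j x| <= K * Num.sqrt (L2sq M (ev v)) /\
  `|dx v j x| <= K * Num.sqrt (L2sq M (ev v)).
Proof.
have [K K0 HK] := mesh_inverse M k.+1; exists K => // v j x xj.
have := HK j (v j) x (size_npoly _) xj.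
set D := Num.sqrt (pint _ _ _) => -[h1 h2].
have KD : K * D <= K * Num.sqrt (L2sq M (ev v)).
  rewrite ler_wpM2l// ler_wsqrtr// L2sqE.
  exact: (pint_le_mint M (fun j => v j : {poly R})).
by split; apply: le_trans KD.
Qed.

Lemma ufluxB (u1 u2 : Vh R n k) i :
  uflux M bc (Vsub u1 u2) i = uflux M bc u1 i - uflux M bc u2 i.
Proof.
rewrite /uflux /boundary_face /avg /trL /trR.
case: eltL => [a|]; case: eltR => [b|] /=; rewrite ?subr0//.
by rewrite /ev !VsubE !hornerD !hornerN -mulrBl; congr (_ / _); ring.
Qed.

Lemma qfluxB (q1 q2 : Vh R n k) i :
  qflux M bc (Vsub q1 q2) i = qflux M bc q1 i - qflux M bc q2 i.
Proof.
rewrite /qflux /avg /trL /trR.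
case: eltL => [a|]; case: eltR => [b|] /=; rewrite ?subr0//.
  by rewrite /ev !VsubE !hornerD !hornerN -mulrBl; congr (_ / _); ring.
all: by rewrite /ev VsubE hornerD hornerN.
Qed.

Lemma gradient_eqB (u1 q1 u2 q2 : Vh R n k) : gradient_eq M bc u1 q1 ->
  gradient_eq M bc u2 q2 -> gradient_eq M bc (Vsub u1 u2) (Vsub q1 q2).
Proof.
move=> g1 g2 p; have := g1 p; have := g2 p.
rewrite !(ipK_horner M (fun j => _ : {poly R}) (fun j => p j : {poly R})).
move=> e2 e1.
transitivity (mint M (fun j => (q1 j : {poly R}) * p j) -
              mint M (fun j => (q2 j : {poly R}) * p j)).
  by rewrite -mintB; apply: eq_bigr => j _; rewrite VsubE mulrBl.
rewrite e1 e2 opprD addrACA -mintB; congr (_ + _).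
  by apply: eq_bigr => j _; rewrite VsubE derivB mulrBl.
rewrite /ipB -sumrB; apply: eq_bigr => j _.
rewrite -sumrB; apply: eq_bigr => s _.
rewrite /of_face ufluxB /tr /ev VsubE hornerD hornerN; ring.
Qed.

(** The flux without its [sigma] term is quadratic in the traces, so its difference is at most
    [D * U], while the jump is at most [2 * D]. The [sigma] term is a square with the favourable
    sign. *)
Lemma entropy_flux_lipschitz (u1 u2 : Vh R n k) (U D : R) i :
  0 <= U -> 0 <= D ->
  (forall j s, `|tr M (ev u1) j s| <= U) ->
  (forall j s, `|tr M (ev u2) j s| <= U) ->
  (forall j s, `|tr M (ev (Vsub u1 u2)) j s| <= D) ->
  - ((entropy_flux M bc sigma u1 i - entropy_flux M bc sigma u2 i)
     * jump M bc (ev (Vsub u1 u2)) i) <= 2 * U * D ^+ 2.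
Proof.
move=> U0 D0 u1U u2U dD.
pose l (v : Vh R n k) := odflt 0 (trL M bc (ev v) i).
pose r (v : Vh R n k) := odflt 0 (trR M bc (ev v) i).
have lP v B : 0 <= B -> (forall j s, `|tr M (ev v) j s| <= B) -> `|l v| <= B.
  move=> B0 vB; rewrite /l /trL; case: eltL => [j|]/=; last by rewrite normr0.
  exact: vB j true.
have rP v B : 0 <= B -> (forall j s, `|tr M (ev v) j s| <= B) -> `|r v| <= B.
  move=> B0 vB; rewrite /r /trR; case: eltR => [j|]/=; last by rewrite normr0.
  exact: vB j false.
(* Taking 0 for a missing trace gives one formula for interior and Dirichlet faces. *)
have FE v : entropy_flux M bc sigma v i =
    3^-1 * ((2^-1 * l v ^+ 2 + 2^-1 * r v ^+ 2) / 2 + ((l v + r v) / 2) ^+ 2)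
    + sigma / h * (l v - r v).
  rewrite /entropy_flux /avg0 /jump /nrm /l /r /trL /trR mulr1 mulrN1.
  by case: eltL => [a|]; case: eltR => [b|] //=; rewrite expr0n/= !mulr0.
have lB : l (Vsub u1 u2) = l u1 - l u2.
  rewrite /l /trL; case: eltL => [j|]/=; rewrite ?subr0//.
  by rewrite /ev VsubE hornerD hornerN.
have rB : r (Vsub u1 u2) = r u1 - r u2.
  rewrite /r /trR; case: eltR => [j|]/=; rewrite ?subr0//.
  by rewrite /ev VsubE hornerD hornerN.
have -> : jump M bc (ev (Vsub u1 u2)) i = l (Vsub u1 u2) - r (Vsub u1 u2).
  by rewrite /jump /nrm mulr1 mulrN1.
have := lP _ _ D0 dD; have := rP _ _ D0 dD; rewrite !FE lB rB.
have := lP _ _ U0 u1U; have := rP _ _ U0 u1U.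
have := lP _ _ U0 u2U; have := rP _ _ U0 u2U.
move: (l u1) (l u2) (r u1) (r u2) => l1 l2 r1 r2 r2U l2U r1U l1U rD lD.
set dl := l1 - l2 in lD *; set dr := r1 - r2 in rD *.
have jD : `|dl - dr| <= 2 * D.
  by apply: le_trans (ler_normB _ _) _; lra.
have X1 : `|dl * (l1 + l2)| <= D * (2 * U).
  by apply: norm_mul_le => //; apply: le_trans (ler_normD _ _) _; lra.
have X2 : `|dr * (r1 + r2)| <= D * (2 * U).
  by apply: norm_mul_le => //; apply: le_trans (ler_normD _ _) _; lra.
have X3 : `|(dl + dr) * (l1 + r1 + (l2 + r2))| <= (2 * D) * (4 * U).
  apply: norm_mul_le; first by apply: le_trans (ler_normD _ _) _; lra.
  apply: le_trans (ler_normD _ _) _.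
  have := ler_normD l1 r1; have := ler_normD l2 r2; lra.
(* Difference of the quadratic parts, each factored as a difference of squares; the bounds 2, 2 and
   8 times [D * U] add up to 12. *)
pose X := (dl * (l1 + l2) + dr * (r1 + r2) +
           (dl + dr) * (l1 + r1 + (l2 + r2))) / 12.
have XUD : `|X| <= D * U.
  move: X1 X2 X3; rewrite /X !ler_norml => /andP[? ?] /andP[? ?] /andP[? ?].
  by apply/andP; split; lra.
have Y := norm_mul_le XUD jD; move: Y; rewrite ler_norml => /andP[Y _].
have Z : 0 <= sigma / h * (dl - dr) ^+ 2.
  by rewrite mulr_ge0 ?sqr_ge0// divr_ge0// ltW// meshsize_gt0.
rewrite (_ : - _ = - (X * (dl - dr)) - sigma / h * (dl - dr) ^+ 2); first lra.
by rewrite /X /dl /dr; field; rewrite gt_eqF// meshsize_gt0.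
Qed.

(** The two evolution equations are subtracted and tested with [d]. By linearity the viscous part is
    [- kappa] times the squared norm of [e]; the rest is quadratic in [d] up to factors bounded
    through [B]. *)
Lemma difference_energy (B : R) : 0 <= B ->
  exists L, forall (ut : broken R n) (u1 q1 w1 u2 q2 w2 : Vh R n k),
    (forall j, {within elt M j, continuous (ut j)}) ->
    gradient_eq M bc u1 q1 -> evolution_eq M bc kappa sigma ut u1 q1 w1 ->
    gradient_eq M bc u2 q2 -> evolution_eq M bc kappa sigma ut u2 q2 w2 ->
    Num.sqrt (L2sq M (ev u1)) <= B -> Num.sqrt (L2sq M (ev u2)) <= B ->
    2 * mint M (fun j => (Vsub w1 w2 j : {poly R}) * Vsub u1 u2 j) <=
    L * L2sq M (ev (Vsub u1 u2)).
Proof.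
move=> B0; have [K K0 HK] := mesh_bound.
pose S := \sum_j (node M (vtx j true) - node M (vtx j false)).
pose N : R := \sum_(i : 'I_n.+2 | face bc i) 1.
(* Here [S] is the length of the domain and [N] the number of faces. The two summands bound the
   volume term [vol] and the flux term [flx]. *)
exists (2 * (K ^+ 3 * B * S + 2 * (K * B) * K ^+ 2 * N)).
move=> ut u1 q1 w1 u2 q2 w2 utc g1 e1 g2 e2 u1B u2B.
set d := Vsub u1 u2; set e := Vsub q1 q2.
set E := L2sq M (ev d); set D := Num.sqrt E.
have E0 : 0 <= E by exact: L2sq_ge0.
have D0 : 0 <= D by exact: sqrtr_ge0.
have DE : D ^+ 2 = E by rewrite sqr_sqrtr.
have U0 : 0 <= K * B by rewrite mulr_ge0.
have KD0 : 0 <= K * D by rewrite mulr_ge0.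
have bnd (v : Vh R n k) j x :
    x \in `[node M (vtx j false), node M (vtx j true)] ->
    Num.sqrt (L2sq M (ev v)) <= B -> `|ev v j x| <= K * B.
  move=> xj vB; have [vK _] := HK v j x xj.
  by apply: le_trans vK _; exact: ler_wpM2l.
(* Half the difference of the squares of [u1] and [u2] is their mean times [d]. *)
pose vol := mint M (fun j =>
  (2^-1 *: ((u1 j : {poly R}) + u2 j)) * d j * (d j : {poly R})^`()).
have volE : vol <= K ^+ 3 * B * S * E.
  rewrite mulrAC /S mulr_sumr; apply: ler_sum => j _.
  apply: le_trans (ler_norm _) _.
  apply: norm_pint => [|x xj]; first exact/ltW/node_lt.
  rewrite !hornerM hornerZ hornerD -DE.
  rewrite [leRHS](_ : _ = (K * B) * (K * D) * (K * D)); last by ring.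
  have [d1 d2] := HK d j x xj.
  apply: norm_mul_le d2; apply: norm_mul_le d1.
  have := bnd u1 j x xj u1B; have := bnd u2 j x xj u2B; rewrite /ev !ler_norml.
  by move=> /andP[? ?] /andP[? ?]; apply/andP; split; lra.
pose flx := \sum_(i | face bc i) - ((entropy_flux M bc sigma u1 i -
  entropy_flux M bc sigma u2 i) * jump M bc (ev d) i).
have flxE : flx <= 2 * (K * B) * K ^+ 2 * N * E.
  rewrite [leRHS](_ : _ = (2 * (K * B) * (K * D) ^+ 2) * N); last first.
    by rewrite -DE; ring.
  rewrite /flx /N mulr_sumr; apply: ler_sum => i _; rewrite mulr1.
  apply: entropy_flux_lipschitz => // j s.
  - exact: bnd (vtx_itv M j s) u1B.
  - exact: bnd (vtx_itv M j s) u2B.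
  - exact: (proj1 (HK d j _ (vtx_itv M j s))).
have visc := viscous_energy (gradient_eqB g1 g2); rewrite -/d -/e in visc.
have Q0 := mint_sqr_ge0 M (fun j => e j : {poly R}).
have -> : mint M (fun j => (Vsub w1 w2 j : {poly R}) * d j) =
    - (kappa * mint M (fun j => (e j : {poly R}) * e j)) + vol + flx.
  transitivity (mint M (fun j => (w1 j : {poly R}) * d j) -
                mint M (fun j => (w2 j : {poly R}) * d j)).
    by rewrite -mintB; apply: eq_bigr => j _; rewrite VsubE mulrBl.
  rewrite (evolution_eqE d utc e1) (evolution_eqE d utc e2).
  rewrite -[X in _ = X + _ + _]mulrN -visc.
  have -> : mint M (fun j => (e j : {poly R}) * (d j : {poly R})^`()) =
      mint M (fun j => (q1 j : {poly R}) * (d j : {poly R})^`()) -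
      mint M (fun j => (q2 j : {poly R}) * (d j : {poly R})^`()).
    by rewrite -mintB; apply: eq_bigr => j _; rewrite VsubE mulrBl.
  have -> : vol =
      mint M (fun j => 2^-1 *: (u1 j : {poly R}) ^+ 2 * (d j : {poly R})^`()) -
      mint M (fun j => 2^-1 *: (u2 j : {poly R}) ^+ 2 * (d j : {poly R})^`()).
    rewrite -mintB; apply: eq_bigr => j _; congr (pint _ _ _).
    rewrite -mulrBl -scalerBr VsubE -scalerAl; congr (_ *: _ * _); ring.
  have -> : flx =
      \sum_(i | face bc i) (kappa * qflux M bc q1 i -
        entropy_flux M bc sigma u1 i) * jump M bc (ev d) i -
      \sum_(i | face bc i) (kappa * qflux M bc q2 i -
        entropy_flux M bc sigma u2 i) * jump M bc (ev d) i -
      kappa * \sum_(i | face bc i) qflux M bc e i * jump M bc (ev d) i.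
    rewrite mulr_sumr -!sumrB; apply: eq_bigr => i _; rewrite qfluxB; ring.
  ring.
have := mulr_ge0 (ltW kappa_gt0) Q0; lra.
Qed.

Lemma uniqueness ut T (u1 q1 u2 q2 : R -> Vh R n k) :
  reference_state M ut ->
  DG_solution M bc kappa sigma ut T u1 q1 ->
  DG_solution M bc kappa sigma ut T u2 q2 ->
  u1 0 = u2 0 ->
  forall t : R, t \in `[0, T] -> u1 t = u2 t /\ q1 t = q2 t.
Proof.
move=> utc s1 s2 u0 t tT.
(* The shared initial norm bounds both solutions at all times, so a single [L] serves in Gronwall's
   inequality. *)
have [L HL] := difference_energy (sqrtr_ge0 (L2sq M (ev (u1 0)))).
have [cu1 g1 e1] := s1; have [cu2 g2 e2] := s2.
pose d s := Vsub (u1 s) (u2 s).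
have dE s j : d s j = (u1 s j : {poly R}) - u2 s j :> {poly R} by [].
have dm j m : (fun s => (d s j : {poly R})`_m) =
    (fun s => (u1 s j : {poly R})`_m) - (fun s => (u2 s j : {poly R})`_m).
  by apply/funext => s; rewrite dE coefB.
have d0 : L2sq M (ev (d t)) = 0.
  apply: (@gronwall_eq0 _ (fun s => L2sq M (ev (d s))) L T) tT.
  - apply: within_continuous_L2sq => j m; rewrite dm.
    exact: within_continuousB (cu1 j m) (cu2 j m).
  - by move=> s; exact: L2sq_ge0.
  - rewrite L2sqE /mint big1// => j _.
    by rewrite dE u0 subrr mulr0 linear0.
  - move=> s sT; have [w1 dw1 ew1] := e1 s sT; have [w2 dw2 ew2] := e2 s sT.
    have sT' : s \in `[0, T] := subset_itv_oo_cc sT.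
    exists (2 * mint M (fun j => (Vsub w1 w2 j : {poly R}) * d s j)).
      under eq_fun do rewrite L2sqE.
      apply: (@is_derive_mint_sqr _ _ _ _ d) => j m; rewrite dm VsubE coefB.
      exact: is_deriveB (dw1 j m) (dw2 j m).
    apply: (HL _ _ _ _ _ _ _ (utc s) (g1 s sT') ew1 (g2 s sT') ew2).
      by rewrite ler_wsqrtr// (L2sq_le_initial utc s1).
    by rewrite ler_wsqrtr// u0 (L2sq_le_initial utc s2).
have u12 : u1 t = u2 t.
  apply/funext => j; apply/val_inj/eqP; rewrite -subr_eq0; apply/eqP.
  move: d0; rewrite L2sqE => d0.
  exact: (mint_sqr_eq0 d0 j).
split=> //; apply/funext => j; apply/val_inj/eqP; rewrite -subr_eq0; apply/eqP.
(* Once the two [u] agree, both gradient equations tested with [e] have the same right-hand side, so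
   [e] is orthogonal to itself. *)
pose e := Vsub (q1 t) (q2 t).
apply: (mint_sqr_eq0 (M := M) (F := fun j => (e j : {poly R})) _ j).
transitivity (mint M (fun j => (q1 t j : {poly R}) * e j) -
              mint M (fun j => (q2 t j : {poly R}) * e j)).
  by rewrite -mintB; apply: eq_bigr => l _; rewrite VsubE mulrBl.
by rewrite (gradient_eqE e (g1 t tT)) (gradient_eqE e (g2 t tT)) u12 subrr.
Qed.
End Stability.

Theorem lemma1 (R : realType) (n k : nat) (M : mesh R n) (bc : bcond)
    (kappa sigma : R) (kappa_gt0 : 0 < kappa) (sigma_ge0 : 0 <= sigma) :
  (exists C : R,
    [/\ 0 <= C, (0 < sigma -> 0 < C)
      & forall (ut : R -> broken R n) (T : R) (u q : R -> Vh R n k),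
          reference_state M ut ->
          DG_solution M bc kappa sigma ut T u q ->
          forall t : R, t \in `[0, T] ->
            L2sq M (ev (u t))
              + C * \int[lebesgue_measure]_(tau in `[0, t]) DGsq M bc (u tau)
            <= L2sq M (ev (u 0))])
  /\
  (forall (ut : R -> broken R n) (T : R) (u1 q1 u2 q2 : R -> Vh R n k),
      reference_state M ut ->
      DG_solution M bc kappa sigma ut T u1 q1 ->
      DG_solution M bc kappa sigma ut T u2 q2 ->
      u1 0 = u2 0 ->
      forall t : R, t \in `[0, T] -> u1 t = u2 t /\ q1 t = q2 t).
Proof.
split; first exact: stability.
by move=> ut T u1 q1 u2 q2; exact: uniqueness.
Qed.
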